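(* An iterated function system $\mathcal{S}=\{S_i\}_{i=1}^k$ of similarities on $\mathbb{R}$ has the weak separation condition if and only if $\sup_{\Delta\in\mathcal{F}}\#V(\Delta)<\infty$, that is, the cardinality $\#V_\alpha(\Delta)$ of the neighbour set of $\Delta$ is bounded uniformly over all $\alpha>0$ and all net intervals $\Delta\in\mathcal{F}_\alpha$.
   Context: An iterated function system (IFS) $\mathcal{S}=\{S_i\}_{i=1}^k$ is a finite set of similarities $S_i(x)=r_ix+d_i:\mathbb{R}\to\mathbb{R}$ with $0<|r_i|<1$ and $k\ge 2$. Its self-similar set $K$ is the unique non-empty compact set with $K=\bigcup_{j=1}^k S_j(K)$. Standing assumption: $K$ is not a singleton and (after rescaling and translating) the convex hull of $K$ is $[0,1]$. Words: $\Sigma=\{1,\dots,k\}$ and $\Sigma^*$ is the set of all finite words on $\Sigma$ (the empty word corresponds to the identity map, with ratio $1$). For $\sigma=(\sigma_1,\dots,\sigma_j)$ put $S_\sigma=S_{\sigma_1}\circ\cdots\circ S_{\sigma_j}$, $r_\sigma=\prod_{i=1}^j r_{\sigma_i}$ and (for $j\ge1$) $\sigma^-=(\sigma_1,\dots,\sigma_{j-1})$. For $\alpha>0$ let $\Lambda_\alpha=\{\sigma\in\Sigma^*: |r_\sigma|<\alpha\le |r_{\sigma^-}|\}$. Weak separation condition: there is some $x_0\in\mathbb{R}$ and an integer $N$ (or, equivalently, for all $x_0$ there is some $N$) such that for any $\alpha>0$ and any finite word $\tau$, any closed ball of radius $\alpha$ contains no more than $N$ distinct points of the form $S_\sigma(S_\tau(x_0))$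 with $\sigma\in\Lambda_\alpha$. Net intervals and neighbour sets: for $\alpha>0$ let $h_1<\dots<h_{s(\alpha)}$ be the distinct elements of $\{S_\sigma(0),S_\sigma(1):\sigma\in\Lambda_\alpha\}$ and $\mathcal{F}_\alpha=\{[h_j,h_{j+1}]:1\le j<s(\alpha),\ (h_j,h_{j+1})\cap K\ne\emptyset\}$ (net intervals of generation $\alpha$); $\mathcal{F}=\bigcup_{\alpha>0}\mathcal{F}_\alpha$. For $\Delta\in\mathcal{F}_\alpha$, $T_\Delta(x)=rx+a$ is the unique such map with $r>0$ and $T_\Delta([0,1])=\Delta$. The neighbour set of $\Delta\in\mathcal{F}_\alpha$ is the set of (distinct) maps $V_\alpha(\Delta)=\{T_\Delta^{-1}\circ S_\sigma:\sigma\in\Lambda_\alpha,\ S_\sigma([0,1])\supseteq\Delta\}$, written $V(\Delta)$ when the generation is implicit. *)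

(* Defs.v *)
From HB Require Import structures.
From mathcomp Require Export all_boot all_order all_algebra.
From mathcomp Require Export all_classical all_reals all_analysis.
From mathcomp Require Import lra.
Export numFieldNormedType.Exports.

Set Implicit Arguments.
Unset Strict Implicit.
Unset Printing Implicit Defensive.

Import Order.TTheory GRing.Theory Num.Theory.

Local Open Scope classical_set_scope.
Local Open Scope ring_scope.

(* The maps are given as an indexed family, so repetitions are allowed;
   everything below that is counted is counted up to equality of points or of
   maps, never of words. *)
Record ifs (R : realType) (k : nat) := IFS {
  ratio : 'I_k -> R;
  shift : 'I_k -> R;
  ratio_bounds : forall i, 0 < `|ratio i| < 1 }.

Definition ifs_map (R : realType) (k : nat) (S : ifs R k) (i : 'I_k) : R -> R :=
  fun x => ratio S i * x + shift S i.

Definition word_map (R : realType) (k : nat) (S : ifs R k) (s : seq 'I_k) :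
  R -> R := foldr (fun i f => ifs_map S i \o f) id s.

Definition word_ratio (R : realType) (k : nat) (S : ifs R k) (s : seq 'I_k) : R :=
  \prod_(i <- s) ratio S i.

Definition word_pred (k : nat) (s : seq 'I_k) : seq 'I_k := take (size s).-1 s.

Definition self_similar_set (R : realType) (k : nat) (S : ifs R k) (K : set R) :=
  [/\ K !=set0, compact K & K = \bigcup_(i in [set: 'I_k]) (ifs_map S i @` K)].

Definition convex_hull (R : realType) (A : set R) : set R :=
  smallest (@convex_set R R^o) A.

(* No word belongs to Lambda S a when 1 < a. *)
Definition Lambda (R : realType) (k : nat) (S : ifs R k) (a : R) : set (seq 'I_k) :=
  [set s | s != [::] /\
           `|word_ratio S s| < a <= `|word_ratio S (word_pred s)| ].

Definition weak_separation (R : realType) (k : nat) (S : ifs R k) :=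
  exists (x0 : R) (N : nat), forall (a : R) (t : seq 'I_k) (c : R), 0 < a ->
    ([set word_map S s (word_map S t x0) | s in Lambda S a] `&` closed_ball c a
       #<= `I_N)%card.

Definition endpoints (R : realType) (k : nat) (S : ifs R k) (a : R) : set R :=
  [set word_map S s 0 | s in Lambda S a] `|` [set word_map S s 1 | s in Lambda S a].

(* h lists the endpoints in strictly increasing order; it is indexed from 0. *)
Definition net_intervals (R : realType) (k : nat) (S : ifs R k) (K : set R) (a : R) :
  set (set R) :=
  [set D : set R | exists (h : seq R) (j : nat),
     [/\ sorted <%R h, [set` h] = endpoints S a, (j.+1 < size h)%N,
         `]h`_j, h`_j.+1[ `&` K !=set0 & D = `[h`_j, h`_j.+1]%classic] ].

(* For a compact interval D of positive length, inf D and sup D are its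
   endpoints; see net_mapP and net_map_unique. *)
Definition net_map (R : realType) (D : set R) : R -> R :=
  fun x => (sup D - inf D) * x + inf D.

Definition net_map_inv (R : realType) (D : set R) : R -> R :=
  fun y => (y - inf D) / (sup D - inf D).

Definition neighbour_set (R : realType) (k : nat) (S : ifs R k) (a : R) (D : set R) :
  set (R -> R) :=
  [set net_map_inv D \o word_map S s |
     s in [set s | Lambda S a s /\ D `<=` word_map S s @` `[0, 1] ] ].

Lemma image_affine (R : realType) (r a : R) : 0 < r ->
  (fun x => r * x + a) @` `[0, 1] = `[a, r + a]%classic.
Proof.
move=> r0; apply/seteqP; split=> [_ [x /= + <-]|y /=].
  by rewrite !in_itv /= => /andP[x0 x1]; apply/andP; split; nra.
rewrite in_itv /= => /andP[ay yr]; exists ((y - a) / r).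
  by rewrite /= in_itv /= divr_ge0 ?subr_ge0 ?(ltW r0) //= ler_pdivrMr // mul1r lerBlDr.
by rewrite mulrCA divff ?gt_eqF // mulr1 subrK.
Qed.

Lemma net_mapP (R : realType) (u v : R) (D : set R) : u < v -> D = `[u, v]%classic ->
  [/\ 0 < sup D - inf D, net_map D @` `[0, 1] = D,
      cancel (net_map D) (net_map_inv D) & cancel (net_map_inv D) (net_map D)].
Proof.
move=> uv ->; rewrite /net_map /net_map_inv sup_itvcc ?inf_itvcc ?ltW //.
have uv0 : 0 < v - u by rewrite subr_gt0.
split=> // [|x|x]; first by rewrite image_affine // subrK.
- by rewrite addrK mulrC mulKf // gt_eqF.
- by rewrite mulrC divfK ?subrK // gt_eqF.
Qed.

Lemma net_map_unique (R : realType) (r a : R) (D : set R) : 0 < r ->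
  (fun x => r * x + a) @` `[0, 1] = D -> net_map D = (fun x => r * x + a).
Proof.
move=> r0 <-; rewrite image_affine // /net_map.
have h : a <= r + a by rewrite lerDr ltW.
by rewrite sup_itvcc // inf_itvcc // addrK.
Qed.

(* Main.v *)
(* If the weak separation condition holds for x0, pick i with S_i(x0) <> x0. A
   map S_s is determined by its values at x0 and S_i(x0); when s ranges over the
   words of Lambda_a such that S_s([0,1]) contains a given point, each of these
   values stays within O(a) of that point, so it takes boundedly many values.
   Conversely, take x0 = 0 and consider the maps S_s, s in Lambda_a, such that
   S_s([0,1]) meets a ball of radius a. Sort them according to the cells of size
   e * a in which S_s(0) and S_s(1) fall: there are boundedly many pairs of
   cells, and if e is small then all the maps in a given pair of cells are
   neighbours of one and the same net interval. *)
From mathcomp Require Import ring lra.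
Require Import Defs.

Set Implicit Arguments.
Unset Strict Implicit.
Unset Printing Implicit Defensive.

Import Order.TTheory GRing.Theory Num.Theory.

Local Open Scope classical_set_scope.
Local Open Scope ring_scope.
Local Open Scope convex_scope.

(** * Counting: bounds on cardinality through numbering functions *)

Lemma card_le_IIP (T : Type) (A : set T) (N : nat) :
  (A #<= `I_N)%card <->
  exists g : T -> nat, (forall x, A x -> (g x < N)%N) /\
    (forall x y, A x -> A y -> g x = g y -> x = y).
Proof.
split=> [/pcard_leP/injfunPex[g gN gi]|[g [gN gi]]].
  by exists g; split=> [x|x y] ? *; [exact: gN|apply: gi => //; exact/mem_set].
apply/pcard_leP/injfunPex; exists g => // x y /set_mem Ax /set_mem Ay.
exact: gi.
Qed.

Lemma card_le_fibers (T : Type) (A : set T) (f : T -> nat) (M N : nat) :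
  (forall x, A x -> (f x < M)%N) ->
  (forall m, (A `&` [set x | f x = m] #<= `I_N)%card) ->
  (A #<= `I_(M * N))%card.
Proof.
move=> fM fN.
have /choice[g gP] : forall m, exists g : T -> nat,
    (forall x, (A `&` [set x | f x = m]) x -> (g x < N)%N) /\
    (forall x y, (A `&` [set x | f x = m]) x -> (A `&` [set x | f x = m]) y ->
       g x = g y -> x = y).
  by move=> m; apply/card_le_IIP.
(* Mixed-radix numbering: the fibre gives the quotient by [N] and the rank inside the fibre the
   remainder, so Euclidean division recovers both. *)
apply/card_le_IIP; exists (fun x => f x * N + g (f x) x)%N; split=> [x Ax|x y Ax Ay].
  have [/(_ x (conj Ax erefl)) gx _] := gP (f x).
  by rewrite (@leq_trans ((f x).+1 * N)) ?leq_mul2r ?fM ?orbT// mulSnr ltn_add2l.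
have [/(_ x (conj Ax erefl)) gx _] := gP (f x).
have [/(_ y (conj Ay erefl)) gy _] := gP (f y).
have N0 : (0 < N)%N by exact: leq_ltn_trans gx.
move=> e; have fe : f x = f y.
  by have := congr1 (divn^~ N) e; rewrite !divnMDl// !divn_small// !addn0.
move: e; rewrite -fe => /addnI e.
by have [_ /(_ x y)] := gP (f x); apply.
Qed.

(** The fibres are those of the integer part of [(f x - b) / e]. There are [L.+1] of them because
    the right end [b + L * e] is allowed and opens a cell of its own. *)
Lemma card_le_cells (R : realType) (T : Type) (A : set T) (f : T -> R)
    (b e : R) (L N : nat) :
  0 < e -> (forall x, A x -> b <= f x <= b + L%:R * e) ->
  (forall p, (A `&` [set x | p <= f x <= p + e] #<= `I_N)%card) ->
  (A #<= `I_(L.+1 * N))%card.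
Proof.
move=> e0 fb fN.
have g0 x : A x -> 0 <= (f x - b) / e.
  by move=> /fb/andP[+ _]; rewrite -subr_ge0 => ?; rewrite divr_ge0// ltW.
apply: (@card_le_fibers _ _ (fun x => Num.truncn ((f x - b) / e))) => [x Ax|m].
  rewrite truncn_lt_nat ?g0// ltr_pdivrMr// ltrBlDl.
  by have /andP[_ /le_lt_trans->]// := fb _ Ax; rewrite ltrD2l ltr_pM2r// ltr_nat.
apply: card_le_trans (fN (b + m%:R * e)); apply: subset_card_le => x [Ax /= xm].
split=> //=; move: (truncn_itv (g0 _ Ax)).
rewrite xm ler_pdivlMr// ltr_pdivrMr// -addn1 natrD => /andP[? ?].
by apply/andP; split; lra.
Qed.

Lemma card_le_transport (T U : Type) (A : set T) (f : T -> U) (B : set U) (N : nat) :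
  (forall x, A x -> B (f x)) ->
  (forall x y, A x -> A y -> f x = f y -> x = y) ->
  (B #<= `I_N)%card -> (A #<= `I_N)%card.
Proof.
move=> fB fi /card_le_IIP[g [gN gi]]; apply/card_le_IIP; exists (g \o f).
by split=> [x /fB/gN//|x y Ax Ay /= /gi e]; apply: fi => //; apply: e; exact: fB.
Qed.

(** * Maps and ratios of words, and finiteness at a given scale *)

Section words.
Variables (R : realType) (k : nat) (S : ifs R k).
Implicit Types (s t : seq 'I_k) (a x y : R).

Lemma word_map_cat s t : word_map S (s ++ t) = word_map S s \o word_map S t.
Proof. by elim: s => //= i s ->. Qed.

Lemma word_ratio_cat s t : word_ratio S (s ++ t) = word_ratio S s * word_ratio S t.
Proof. by rewrite /word_ratio big_cat. Qed.

Lemma word_mapB s x y : word_map S s x - word_map S s y = word_ratio S s * (x - y).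
Proof.
rewrite /word_ratio; elim: s => [|i s IHs] /=; first by rewrite big_nil mul1r.
by rewrite big_cons /ifs_map opprD addrACA subrr addr0 -mulrBr IHs mulrA.
Qed.

(** Lets a map be handled through its values at [0] and [1], whatever the sign of its ratio. *)
Lemma word_mapE s x : word_map S s x =
  (1 - x) * word_map S s 0 + x * word_map S s 1.
Proof.
have h0 := word_mapB s x 0; have h1 := word_mapB s 1 0.
by move: h0 h1; rewrite !subr0 mulr1 => + rE; rewrite -rE => ?; lra.
Qed.

(** The increment between the two points gives the ratio, and one value then fixes the
    translation. *)
Lemma word_map_eq s t x y : x != y -> word_map S s x = word_map S t x ->
  word_map S s y = word_map S t y -> word_map S s = word_map S t.
Proof.
move=> xy sx sy; have rE : word_ratio S s = word_ratio S t.
  apply: (@mulIf _ (x - y)); first by rewrite subr_eq0.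
  by rewrite -!word_mapB sx sy.
apply/funext => z; apply: (@addIr _ (- word_map S s x)).
by rewrite {2}sx !word_mapB rE.
Qed.

Lemma word_ratio_gt0 s : 0 < `|word_ratio S s|.
Proof.
rewrite normr_gt0 /word_ratio prodf_seq_neq0; apply/allP => i _ /=.
by have /andP[] := ratio_bounds S i; rewrite normr_gt0.
Qed.

Lemma ratio_max : exists2 r : R, 0 <= r < 1 & forall i, `|ratio S i| <= r.
Proof.
exists (\big[Num.max/0]_i `|ratio S i|); last by move=> i; exact: le_bigmax.
rewrite bigmax_ge_id /=; apply/bigmax_ltP; split=> // i _.
by have /andP[] := ratio_bounds S i.
Qed.

Lemma ratio_min : exists2 r : R, 0 < r & forall i, r <= `|ratio S i|.
Proof.
exists (\big[Num.min/1]_i `|ratio S i|); last by move=> i; exact: bigmin_le.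
by apply: lt_bigmin => // i _; have /andP[] := ratio_bounds S i.
Qed.

Lemma word_ratio_le r s : 0 <= r -> (forall i, `|ratio S i| <= r) ->
  `|word_ratio S s| <= r ^+ size s.
Proof.
move=> r0 rle; rewrite /word_ratio; elim: s => [|i s IHs] /=.
  by rewrite big_nil normr1 expr0.
by rewrite big_cons normrM exprS ler_pM.
Qed.

Lemma word_ratio_small (e : R) : 0 < e ->
  exists n, forall s, (n <= size s)%N -> `|word_ratio S s| < e.
Proof.
move=> e0; have [r /andP[r0 r1] rle] := ratio_max.
have : @GRing.exp R r @ \oo --> 0 by apply: cvg_expr; rewrite ger0_norm.
move=> /cvgr0_norm_lt/(_ _ e0)[n _ nP]; exists n => s ns.
apply: le_lt_trans (word_ratio_le s r0 rle) _.
by have := nP _ ns; rewrite /= ger0_norm // exprn_ge0.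
Qed.

Lemma finite_words n : finite_set [set s : seq 'I_k | (size s <= n)%N].
Proof.
elim: n => [|n IHn].
  by apply: (sub_finite_set _ (finite_set1 [::])) => -[].
apply: (@sub_finite_set _ _ ([set [::]] `|`
    [set i :: s | i in [set: 'I_k] & s in [set s | (size s <= n)%N]])).
  by move=> [|i s] /= sn; [left|right; exists i => //; exists s].
by rewrite finite_setU; split=> //; apply: finite_image2.
Qed.

(** Without its last letter such a word still has ratio at least [a] in absolute value, which bounds
    its length. *)
Lemma finite_Lambda a : 0 < a -> finite_set (Lambda S a).
Proof.
move=> /word_ratio_small[n nP]; apply: sub_finite_set (finite_words n) => s.
move=> [s0 /andP[_ ale]] /=; rewrite leqNgt; apply: contraTN ale => ns.
rewrite -ltNge; apply: nP; rewrite /word_pred size_take.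
by case: (size s) ns => // m; rewrite /= leqnn.
Qed.

Lemma finite_endpoints a : 0 < a -> finite_set (endpoints S a).
Proof.
by move=> a0; rewrite finite_setU; split; apply: finite_image; exact: finite_Lambda.
Qed.

(** The last letter multiplies a ratio of absolute value at least [a] by a factor of absolute value
    at least [r]. *)
Lemma Lambda_ratio_ge r a s : (forall i, r <= `|ratio S i|) -> 0 < r -> Lambda S a s ->
  r * a <= `|word_ratio S s|.
Proof.
move=> rle r0 [s0 /andP[_]]; case/lastP: s s0 => // s i _.
rewrite /word_pred size_rcons /= -cats1 take_size_cat// word_ratio_cat.
rewrite normrM mulrC [word_ratio S [:: i]]big_seq1 => ale.
have [a0|/ltW a0] := leP 0 a; first by rewrite ler_pM// ltW.
by rewrite (@le_trans _ _ 0) ?mulr_le0_ge0// ?ltW// mulr_ge0.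
Qed.

End words.

(** * Net intervals around a point that is not an endpoint *)

Lemma sorted_bracket (R : realType) (h : seq R) (p q z : R) :
  sorted <%R h -> z \notin h -> p \in h -> q \in h -> p < z -> z < q ->
  exists j, [/\ (j.+1 < size h)%N, h`_j < z, z < h`_j.+1 &
    forall x, x \in h -> (x <= z -> x <= h`_j) /\ (z <= x -> h`_j.+1 <= x)].
Proof.
move=> hs zh ph qh pz zq.
have qn : has (fun x => z < x) h by apply/hasP; exists q.
have zn := nth_find 0 qn; have nh := qn; rewrite has_find in nh.
have lt_find i : (i < size h)%N -> h`_i <= z -> (i < find (fun x => z < x)%R h)%N.
  move=> ih iz; rewrite ltnNge; apply/negP => ni.
  have ni' : h`_(find (fun x => z < x)%R h) <= h`_i by rewrite lt_sorted_leq_nth.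
  by have := lt_le_trans zn (le_trans ni' iz); rewrite ltxx.
have before i : (i < find (fun x => z < x)%R h)%N -> h`_i <= z.
  by move=> /(before_find 0)/negbT; rewrite -leNgt.
(* The bracket consists of the first entry above [z] and its predecessor, which exists because
   [p < z] precedes that entry. *)
move: (find (fun x => z < x)%R h) before zn nh lt_find => [|j] before zj jh lt_find.
  by have := lt_find (index p h); rewrite index_mem ph nth_index// ltW// => /(_ isT isT).
exists j; split=> //.
  rewrite lt_neqAle; apply/andP; split.
    by apply: contraNneq zh => <-; rewrite mem_nth// ltnW.
  by rewrite before.
move=> x xh; rewrite -(nth_index 0 xh); have ih := xh; rewrite -index_mem in ih.
split=> [xz|zx].
  have xj : (index x h <= j)%N by rewrite -ltnS lt_find.
  by rewrite lt_sorted_leq_nth// inE (leq_trans _ jh)// ltnS ltnW.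
rewrite lt_sorted_leq_nth// ltnNge; apply/negP; rewrite -ltnS => /before.
move=> iz; have zi : z = h`_(index x h) by apply/le_anti; rewrite zx iz.
by move: zh; rewrite zi nth_index// xh.
Qed.

(** The two cases correspond to the sign of the ratio: a negative one reverses the order of the
    ends. *)
Lemma mem_word_segment (R : realType) (k : nat) (S : ifs R k) (s : seq 'I_k) (y : R) :
  (word_map S s @` `[0, 1]) y <->
  (word_map S s 0 <= y <= word_map S s 1) \/ (word_map S s 1 <= y <= word_map S s 0).
Proof.
set p := word_map S s 0; set q := word_map S s 1; split=> [[x /=]|].
  rewrite in_itv /= word_mapE -/p -/q => /andP[x0 x1] <-.
  have [pq|/ltW qp] := leP p q; [left|right]; apply/andP; split; nra.
have pq : p != q.
  rewrite eq_sym -subr_eq0 /p /q word_mapB subr0 mulr1 -normr_gt0.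
  exact: word_ratio_gt0.
rewrite neq_lt in pq => yE; exists ((y - p) / (q - p)); last first.
  rewrite word_mapE -/p -/q.
  have qp0 : q - p != 0 by rewrite subr_eq0 eq_sym neq_lt.
  have := mulfVK qp0 (y - p); nra.
rewrite /= in_itv /=; case/orP: pq => pq.
  have {}yE : p <= y <= q by case: yE => // /andP[? ?]; apply/andP; split; lra.
  by rewrite divr_ge0 ?ler_pdivrMr ?mul1r ?lerB ?subr_gt0 ?subr_ge0 ?(ltW pq)//; lra.
have {}yE : q <= y <= p by case: yE => // /andP[? ?]; apply/andP; split; lra.
rewrite -mulrNN -invrN !opprB.
by rewrite divr_ge0 ?ler_pdivrMr ?mul1r ?lerB ?subr_gt0 ?subr_ge0 ?(ltW pq)//; lra.
Qed.

(** [D] is the gap between the consecutive endpoints around [z]. An image containing [z] has one end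
    on each side of [z], and neither end lies inside the gap. *)
Lemma net_interval_around (R : realType) (k : nat) (S : ifs R k) (K : set R)
    (a z : R) (s : seq 'I_k) :
  0 < a -> K z -> ~ endpoints S a z -> Lambda S a s ->
  (word_map S s @` `[0, 1]) z ->
  exists D, [/\ net_intervals S K a D,
    exists u v, u < v /\ D = `[u, v]%classic &
    forall t, Lambda S a t -> (word_map S t @` `[0, 1]) z ->
      D `<=` word_map S t @` `[0, 1]].
Proof.
move=> a0 Kz ze sL zs.
have [h0 h0E] := (finite_seqP _).1 (finite_endpoints S a0).
pose h := sort <=%R (undup h0).
have hE : [set` h] = endpoints S a.
  by rewrite h0E; apply/seteqP; split=> x /=; rewrite mem_sort mem_undup.
have mh x : endpoints S a x <-> x \in h by rewrite -hE.
have hs : sorted <%R h by rewrite lt_sorted_uniq_le sort_uniq undup_uniq sort_le_sorted.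
have ends t : Lambda S a t -> word_map S t 0 \in h /\ word_map S t 1 \in h.
  by move=> tL; split; apply/mh; [left|right]; exists t.
have zh : z \notin h by apply/negP => /mh.
have lt_end x : x \in h -> x <= z -> x < z.
  by move=> xh; rewrite le_eqVlt => /orP[/eqP xz|//]; rewrite xz (negPf zh) in xh.
have gt_end x : x \in h -> z <= x -> z < x.
  by move=> xh; rewrite le_eqVlt => /orP[/eqP xz|//]; rewrite -xz (negPf zh) in xh.
have [p [q [ph qh pz zq]]] : exists p q, [/\ p \in h, q \in h, p < z & z < q].
  have [e0 e1] := ends _ sL.
  by move/mem_word_segment: zs => [] /andP[? ?];
    [exists (word_map S s 0), (word_map S s 1) |
     exists (word_map S s 1), (word_map S s 0)]; split; auto.
have [j [jh jz zj hj]] := sorted_bracket hs zh ph qh pz zq.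
exists `[h`_j, h`_j.+1]%classic; split.
- exists h, j; split=> //; exists z; split=> //=.
  by rewrite in_itv /= jz.
- by exists h`_j, h`_j.+1; rewrite (lt_trans jz zj).
move=> t tL zt y /=; rewrite in_itv /= => /andP[jy yj]; apply/mem_word_segment.
have [/hj[p0 q0] /hj[p1 q1]] := ends _ tL.
move/mem_word_segment: zt => [] /andP[h1 h2]; [left|right]; apply/andP; split.
- exact: le_trans (p0 h1) jy.
- exact: le_trans yj (q1 h2).
- exact: le_trans (p1 h1) jy.
- exact: le_trans yj (q0 h2).
Qed.

(** * Self-similar sets with convex hull [[0, 1]] *)

Section self_similar.
Variables (R : realType) (k : nat) (S : ifs R k) (K : set R).
Hypothesis hK : self_similar_set S K.
Hypothesis hull : convex_hull K = `[0, 1]%classic.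

Lemma self_similar_itv : K `<=` `[0, 1].
Proof. by rewrite -hull; exact: sub_gen_smallest. Qed.

(** The interval from the minimum to the maximum of [K] is convex and contains [K], hence contains
    the hull [[0, 1]]; so these extrema are [0] and [1]. *)
Lemma hull_extremal : K 0 /\ K 1.
Proof.
have [K0 cK _] := hK.
have cid : {within K, continuous (@id R)} by apply: continuous_subspaceT => x; exact: cvg_id.
have [m /set_mem Km mle] := compact_EVT_min K0 cK cid.
have [M /set_mem KM leM] := compact_EVT_max K0 cK cid.
have mM : m <= M by apply: mle; exact/mem_set.
have sub : `[0, 1]%classic `<=` `[m, M]%classic.
  have conv_mM (x y : R^o) (l : {i01 R}) : m <= x -> y <= M -> x <= y ->
      m <= x <| l |> y <= M.
    move=> mx yM /(convR_itv l); rewrite in_itv /= => /andP[xl ly].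
    by rewrite (le_trans mx xl) (le_trans ly yM).
  rewrite -hull; apply: smallest_sub => [x y l /set_mem /=|x Kx /=].
    rewrite in_itv => /= /andP[mx xM] /set_mem /=; rewrite in_itv => /= /andP[my yM].
    apply/mem_set; rewrite /= in_itv /=.
    by have [xy|/ltW yx] := leP x y; [|rewrite convC]; exact: conv_mM.
  by rewrite in_itv /= mle ?leM ?inE.
have /sub : `[0, 1]%classic (0 : R) by rewrite /= in_itv /= lexx ler01.
have /sub : `[0, 1]%classic (1 : R) by rewrite /= in_itv /= lexx ler01.
move: (self_similar_itv Km) (self_similar_itv KM); rewrite /= !in_itv /=.
move=> /andP[m0 _] /andP[_ M1] /andP[_ M1'] /andP[m0' _].
by split; [have <- : m = 0 by lra|have <- : M = 1 by lra].
Qed.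

Lemma word_map_self_similar s x : K x -> K (word_map S s x).
Proof.
move=> Kx; elim: s => //= i s IHs; have [_ _ ->] := hK.
by exists i => //; exists (word_map S s x).
Qed.

Lemma self_similar_word n x : K x ->
  exists s y, [/\ size s = n, K y & x = word_map S s y].
Proof.
elim: n x => [x Kx|n IHn x]; first by exists [::], x.
have [_ _ {1}->] := hK; move=> [i _ [y /IHn[s [z [sn Kz ->]]] <-]].
by exists (i :: s), z; rewrite /= sn.
Qed.

Lemma word_map_itv s x : K x -> 0 <= word_map S s x <= 1.
Proof. by move=> /(word_map_self_similar s)/self_similar_itv; rewrite /= in_itv. Qed.

(* If every [S_i] fixed [x], then the end of [0, 1] farthest from [x], which is
   in [K], would be contracted strictly towards [x]. *)
Lemma not_common_fixpoint x : exists i, ifs_map S i x != x.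
Proof.
apply: contrapT => /forallNP fixed.
have far e : K e -> e != x -> exists2 y, 0 <= y <= 1 & `|e - x| < `|y - x|.
  have [_ _ {1}->] := hK => -[i _ [y Ky <-]].
  have := fixed i => /negP; rewrite negbK => /eqP xE.
  have SxE : ifs_map S i y - x = ratio S i * (y - x).
    by rewrite -{1}xE /ifs_map; ring.
  rewrite -subr_eq0 SxE mulf_eq0 negb_or => /andP[_ yx].
  have /andP[_ r1] := ratio_bounds S i; exists y; first exact: self_similar_itv.
  by rewrite normrM gtr_pMl// normr_gt0.
have [K0 K1] := hull_extremal; have [x2|x2] := leP x (1 / 2).
  have [|y /andP[y0 y1]] := far _ K1; first by apply/eqP; lra.
  by rewrite ger0_norm ?lter_normr => [/orP[]|]; lra.
have [|y /andP[y0 y1]] := far _ K0; first by apply/eqP; lra.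
by rewrite ler0_norm ?lter_normr => [/orP[]|]; lra.
Qed.

(** Iterating [S_i] from a point of [K] other than its fixed point [p] gives points whose distances
    to [p] decrease strictly. *)
Lemma self_similar_infinite (i : 'I_k) : infinite_set K.
Proof.
have [K0 K1] := hull_extremal; have /andP[r0 r1] := ratio_bounds S i.
(* [0] and [1] cannot both be fixed, since the ratio would then be [1]. *)
have [x Kx Sx] : exists2 x, K x & ifs_map S i x != x.
  have [S0|S0] := eqVneq (ifs_map S i 0) 0; last by exists 0.
  exists 1 => //; move: S0; rewrite /ifs_map mulr0 add0r => ->; rewrite addr0 mulr1.
  by apply: contraTneq r1 => ->; rewrite normr1 ltxx.
have r1' : 1 - ratio S i != 0.
  by rewrite subr_eq0; apply: contraTneq r1 => <-; rewrite normr1 ltxx.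
pose p := shift S i / (1 - ratio S i).
have Sp : ifs_map S i p = p by rewrite /ifs_map /p; field.
have xp : `|x - p| != 0.
  by rewrite normr_eq0 subr_eq0; apply: contraNneq Sx => ->; rewrite Sp.
have orbit n : word_map S (nseq n i) x - p = ratio S i ^+ n * (x - p).
  rewrite -[in LHS](_ : word_map S (nseq n i) p = p); last first.
    by elim: n => //= n ->.
  rewrite word_mapB /word_ratio; congr (_ * _).
  by elim: n => [|n IHn] /=; rewrite ?big_nil// big_cons IHn exprS.
apply/infiniteP/pcard_leP/injfunPex; exists (fun n => word_map S (nseq n i) x).
  by move=> n _; exact: word_map_self_similar.
move=> m n _ _ /(congr1 (fun y => `|y - p|)); rewrite !orbit !normrM !normrX.
move=> /(mulIf xp) e; apply/le_anti.
by rewrite !leEnat -!(ler_iXn2l r0 r1) e lexx.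
Qed.

(** [S_i(0)] and [S_i(1)] are distinct points of [K] at distance less than [1], so they cannot both
    lie in [{0, 1}]. *)
Lemma self_similar_interior (i : 'I_k) : exists2 y, K y & 0 < y < 1.
Proof.
have [K0 K1] := hull_extremal; have /andP[r0 r1] := ratio_bounds S i.
have := word_mapB S [:: i] 1 0; rewrite subr0 mulr1 /word_ratio big_seq1.
have [Ku Kv] := (word_map_self_similar [:: i] K0, word_map_self_similar [:: i] K1).
have [u01 v01] := (word_map_itv [:: i] K0, word_map_itv [:: i] K1).
move: Ku Kv u01 v01.
move: (word_map _ _ 0) (word_map _ _ 1) => u v Ku Kv /andP[u0 u1] /andP[v0 v1] vu.
have [|] := boolP (0 < u < 1); first by exists u.
rewrite negb_and -!leNgt => uE; exists v => //.
rewrite -vu in r0 r1; rewrite normr_gt0 subr_eq0 in r0.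
rewrite lt_neqAle (lt_neqAle v) v0 v1 !andbT.
move: r1; rewrite ltr_norml => /andP[r1 r1'].
case/orP: uE => uE.
  have {}uE : u = 0 by lra.
  by rewrite uE in r0 r1 r1'; rewrite eq_sym r0 lt_eqF//; lra.
have {}uE : u = 1 by lra.
by rewrite uE in r0 r1 r1'; rewrite r0 andbT lt_eqF//; lra.
Qed.

(** A long enough address of a point [y] of [K] inside [(0, 1)] has an image too short to come near
    [0] or [1]. *)
Lemma interior_word (i : 'I_k) : exists s (d : R), 0 < d /\
  forall x, K x -> d <= word_map S s x <= 1 - d.
Proof.
have [y Ky /andP[y0 y1]] := self_similar_interior i.
(* Half the distance from [y] to the ends: one half is spent on the size of the image, the other
   remains as margin. *)
pose d := Num.min y (1 - y) / 2.
have m0 : 0 < Num.min y (1 - y) by rewrite lt_min y0 subr_gt0.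
have d0 : 0 < d by rewrite divr_gt0.
have [n nP] := word_ratio_small S d0.
have [s [y' [sn Ky' yE]]] := self_similar_word n Ky.
exists s, d; split=> // x /self_similar_itv; rewrite /= in_itv /= => /andP[x0 x1].
have /andP[y'0 y'1] : 0 <= y' <= 1 by have /= := self_similar_itv Ky'; rewrite in_itv.
have : `|word_map S s x - y| <= d.
  rewrite yE word_mapB normrM -[leRHS]mulr1; apply: ler_pM => //.
    by rewrite ltW// nP// sn.
  by rewrite ler_norml; apply/andP; split; lra.
rewrite ler_norml => /andP[h1 h2].
have dy : d <= y / 2 by rewrite /d ler_pM2r// ge_min lexx.
have dy' : d <= (1 - y) / 2 by rewrite /d ler_pM2r// ge_min lexx orbT.
by apply/andP; split; lra.
Qed.

(* All the maps close enough to [S_s] at scale [a] contain in the interior of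
   their images a common point of [K] which is not an endpoint, hence they are
   neighbours of the same net interval. *)
Lemma common_net_interval (i : 'I_k) : exists2 e : R, 0 < e &
  forall a s, 0 < a -> Lambda S a s ->
  exists D, [/\ net_intervals S K a D,
    exists u v, u < v /\ D = `[u, v]%classic &
    forall t, Lambda S a t -> `|word_map S t 0 - word_map S s 0| <= e * a ->
      `|word_map S t 1 - word_map S s 1| <= e * a ->
      D `<=` word_map S t @` `[0, 1]].
Proof.
have [w [d [d0 dP]]] := interior_word i; have [r r0 rP] := ratio_min S.
(* The image under [S_t] has length at least [r * a], so [S_t(x)] with [d <= x <= 1 - d] is at least
   [d * r * a] away from its ends. Moving both ends by at most this much keeps [S_s(x)] inside. *)
exists (d * r) => [|a s a0 sL]; first exact: mulr_gt0.
(* [S_(s ++ w)] is injective and [K] is infinite, whereas there are finitely many endpoints. *)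
have [y Ky ze] : exists2 y, K y & ~ endpoints S a (word_map S (s ++ w) y).
  apply: contrapT => /forall2NP swE; apply: (self_similar_infinite i).
  apply: card_le_finite (finite_endpoints S a0).
  apply/pcard_leP/injfunPex; exists (word_map S (s ++ w)) => [y Ky|x y _ _ /eqP].
    by have [//|/contrapT] := swE y.
  rewrite -subr_eq0 word_mapB mulf_eq0 -normr_eq0 gt_eqF ?word_ratio_gt0//=.
  by rewrite subr_eq0 => /eqP.
have Kz := word_map_self_similar (s ++ w) Ky.
move: Kz ze; rewrite word_map_cat /=; have /andP[dx xd] := dP y Ky.
move: (word_map S w y) dx xd => x dx xd Kz ze.
have [|D [Dnet Duv DP]] := net_interval_around a0 Kz ze sL.
  by exists x => //=; rewrite in_itv /=; apply/andP; split; lra.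
exists D; split=> // t tL t0 t1; apply: DP => //; apply/mem_word_segment.
rewrite [word_map S s x]word_mapE.
have := Lambda_ratio_ge rP r0 tL.
have := word_mapB S t 1 0; rewrite subr0 mulr1 => <-.
move: t0 t1; rewrite distrC [`|word_map S t 1 - word_map S s 1|]distrC.
move: (word_map S t 0) (word_map S t 1) (word_map S s 0) (word_map S s 1).
move=> p q p' q'; rewrite !ler_norml -mulrA => /andP[p1 p2] /andP[q1 q2].
set b := r * a in p1 p2 q1 q2 *; move=> bq.
have b0 : 0 < b by exact: mulr_gt0.
have x1 : x <= 1 by lra.
have lo : - (d * b) <= (1 - x) * (p' - p) + x * (q' - q).
  rewrite (_ : - (d * b) = (1 - x) * - (d * b) + x * - (d * b)); last by ring.
  by rewrite lerD// ler_wpM2l//; lra.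
have hi : (1 - x) * (p' - p) + x * (q' - q) <= d * b.
  rewrite (_ : d * b = (1 - x) * (d * b) + x * (d * b)); last by ring.
  by rewrite lerD// ler_wpM2l//; lra.
have dxb c : b <= c -> d * b <= x * c /\ d * b <= (1 - x) * c.
  by move=> bc; split; apply: ler_pM; lra.
have [pq|/ltW qp] := leP p q; [left|right].
  move: bq; rewrite ger0_norm ?subr_ge0// => /dxb[h1 h2].
  by apply/andP; split; lra.
move: bq; rewrite ler0_norm ?subr_le0// opprB => /dxb[h1 h2].
by apply/andP; split; lra.
Qed.

Lemma card_local_maps (i : 'I_k) (N : nat) :
  (forall a D, 0 < a -> net_intervals S K a D -> (neighbour_set S a D #<= `I_N)%card) ->
  exists M, forall a c : R, 0 < a ->
    ([set word_map S s | s in [set s | Lambda S a s /\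
        exists2 x, 0 <= x <= 1 & `|word_map S s x - c| <= a]] #<= `I_M)%card.
Proof.
move=> NP; have [e e0 eP] := common_net_interval i.
(* Cells of size [a / Q] are then finer than [e * a]. *)
pose Q := Num.bound e^-1.
have eQ : e^-1 < Q%:R by rewrite archi_boundP// invr_ge0 ltW.
have Q0 : 0 < Q%:R :> R by rewrite (lt_trans _ eQ)// invr_gt0.
have Qe : Q%:R^-1 < e by rewrite invf_plt.
(* An image comes within [a] of [c] and has length below [a], so [f 0] and [f 1] lie within [2 * a]
   of [c]: a window of [4 * Q] cells. *)
exists ((4 * Q).+1 * ((4 * Q).+1 * N))%N => a c a0.
set A := [set word_map S s | s in _].
have A2 y f : 0 <= y <= 1 -> A f -> c - 2 * a <= f y <= c - 2 * a + (4 * Q)%:R * (a / Q%:R).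
  move=> /andP[y0 y1] [s [[s0 /andP[sa _]] [x /andP[x0 x1]]]] xc <-.
  have : `|word_map S s y - word_map S s x| <= a.
    rewrite word_mapB normrM -[leRHS]mulr1; apply: ler_pM => //; first exact: ltW.
    by rewrite ler_norml; apply/andP; split; lra.
  have -> : (4 * Q)%:R * (a / Q%:R) = 4 * a :> R.
    by rewrite natrM; field; rewrite gt_eqF.
  by move: xc; rewrite !ler_norml => /andP[? ?] /andP[? ?]; apply/andP; split; lra.
have aQ : 0 < a / Q%:R by rewrite divr_gt0.
apply: (@card_le_cells R (R -> R) A (fun f => f 0) _ _ _ _ aQ) => [f|p].
  by apply: A2; rewrite lexx ler01.
apply: (@card_le_cells R (R -> R) _ (fun f => f 1) _ _ _ _ aQ) => [f [Af _]|q].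
  by apply: A2 => //; rewrite lexx ler01.
set B := (X in (X #<= _)%card).
(* Any map in the pair of cells serves as the reference [S_s]; the others are close to it at both
   [0] and [1]. *)
have [->|/set0P[_ [[[s [sL _] <-] /= sp] /= sq]]] := eqVneq B set0.
  exact: card_ge0.
have [D [Dnet [u [v [uv DE]]] DP]] := eP _ _ a0 sL.
have [_ _ _ netK] := net_mapP uv DE.
(* Composition with [net_map_inv D] is injective, so distinct maps give distinct neighbours of
   [D]. *)
apply: card_le_transport (NP _ _ a0 Dnet) => [f [[[t [tL _] <-] /= tp] /= tq]|f g _ _ fg].
  have close x y b : b <= x <= b + a / Q%:R -> b <= y <= b + a / Q%:R -> `|x - y| <= e * a.
    move=> /andP[x1 x2] /andP[y1 y2]; have h : a / Q%:R <= e * a.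
      by rewrite mulrC ler_pM2r// ltW.
    by rewrite ler_norml; apply/andP; split; lra.
  exists t => //; split=> //; apply: DP => //; [exact: close tp sp|exact: close tq sq].
apply/funext => x; apply: (can_inj netK); exact: (congr1 (@^~ x) fg).
Qed.

End self_similar.

(** * From separation of points to bounded neighbour sets, and back *)

Lemma card_word_points (R : realType) (k : nat) (S : ifs R k) (z : R) (N : nat) :
  (forall a c : R, 0 < a ->
     ([set word_map S s z | s in Lambda S a] `&` closed_ball c a #<= `I_N)%card) ->
  exists M, forall a c : R, 0 < a ->
    ([set word_map S s z | s in
       [set s | Lambda S a s /\ (word_map S s @` `[0, 1]) c]] #<= `I_M)%card.
Proof.
(* [L] exceeds the distance from [z] to any point of [[0, 1]], so [S_s(z)] stays within [L * a] of
   [c]. *)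
move=> NP; pose L := Num.bound (`|z| + 1).
have zL : `|z| + 1 < L%:R by rewrite archi_boundP// addr_ge0.
exists ((2 * L).+1 * N)%N => a c a0.
apply: (@card_le_cells R R _ id (c - L%:R * a) a) => // [y [s [[s0 /andP[sa _]] [x /=]]]|p].
  rewrite in_itv /= => /andP[x0 x1] <- <-.
  have : `|word_map S s z - word_map S s x| <= a * L%:R.
    rewrite word_mapB normrM; apply: ler_pM => //; first exact: ltW.
    apply/ltW/(le_lt_trans _ zL).
    by rewrite (le_trans (ler_normB _ _))// lerD2l ger0_norm.
  by rewrite natrM ler_norml => /andP[? ?]; apply/andP; split; lra.
(* The cell [[p, p + a]] lies in the ball of radius [a] centred at [p]. *)
apply: card_le_trans (NP a p a0); apply: subset_card_le => y [[s [sL _] <-] /= /andP[py yp]].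
split; first by exists s.
by rewrite closed_ball_itv//= in_itv /= yp andbT; lra.
Qed.

Theorem proposition2p8 (R : realType) (k : nat) (hk : (2 <= k)%N)
    (S : ifs R k) (K : set R) (hK : self_similar_set S K)
    (hK1 : forall x : R, K <> [set x])
    (hull : convex_hull K = `[0, 1]%classic) :
  weak_separation S <->
  exists N : nat, forall (a : R) (D : set R),
    0 < a -> net_intervals S K a D -> (neighbour_set S a D #<= `I_N)%card.
Proof.
split=> [[x0 [N NP]]|[N NP]].
  have [i ix0] := not_common_fixpoint hK hull x0.
  (* The words [[::]] and [[:: i]] in the role of [t] give the counts at [x0] and at [S_i(x0)]. *)
  have [M1 M1P] := @card_word_points R k S x0 N (fun a c => NP a [::] c).
  have [M2 M2P] := @card_word_points R k S (ifs_map S i x0) N (fun a c => NP a [:: i] c).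
  exists (M1 * M2)%N => a D a0 [h [j [hs _ jh _ DE]]].
  (* The left end of [D] is the given point common to all the images. *)
  have Dc : D h`_j.
    rewrite DE /= in_itv /= lexx ltW// lt_sorted_ltn_nth ?inE//.
    exact: ltnW.
  pose A := [set word_map S s | s in
    [set s | Lambda S a s /\ D `<=` word_map S s @` `[0, 1]]].
  suff : (A #<= `I_(M1 * M2))%card.
    move=> cA; apply: (card_le_trans _ cA).
    apply: (card_le_trans _ (card_image_le (fun f : R -> R => net_map_inv D \o f) A)).
    by apply: subset_card_le => _ [s sP <-]; exists (word_map S s) => //; exists s.
  have AP z f : A f -> [set word_map S s z | s in
       [set s | Lambda S a s /\ (word_map S s @` `[0, 1]) h`_j]] (f z).
    by move=> [s [sL sD] <-]; exists s => //; split=> //; exact: sD.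
  have /card_le_IIP[g [gM gi]] := M1P a h`_j a0.
  (* Fibres of the value at [x0]; on each one the value at [S_i(x0)] determines the map. *)
  apply: (@card_le_fibers _ _ (fun f => g (f x0))) => [f Af|m].
    exact/gM/AP.
  apply: card_le_transport (M2P a h`_j a0) => [f [Af _]|]; first exact: AP Af.
  move=> _ _ [[s sP <-] /= <-] [[t tP <-] /= gst] st.
  apply: word_map_eq st _; first exact: ix0.
  by apply: gi; [apply: AP; exists s|apply: AP; exists t|].
have [M MP] := card_local_maps hK hull (Ordinal hk) NP.
(* Since [0] is in [K], each [S_t(0)] lies in [[0, 1]]. Hence one bound on the maps whose images
   come within [a] of [c] serves for all [t], by evaluation at [S_t(0)]. *)
exists 0, M => a t c a0; have [K0 _] := hull_extremal hK hull.
apply: card_le_trans (MP a c a0).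
apply: card_le_trans (card_image_le (fun f => f (word_map S t 0)) _).
apply: subset_card_le => _ [[s sL <-]]; rewrite closed_ball_itv//= in_itv /= => /andP[cs sc].
exists (word_map S s) => //; exists s => //; split=> //.
exists (word_map S t 0); first exact: (word_map_itv hK hull t K0).
by rewrite ler_norml; apply/andP; split; lra.
Qed.
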